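(* Let $k\in\mathbb{N}\cup\{\infty\}$. Assume that the Banach spaces $E$, $F$ satisfy the following properties: (1) For every continuous mapping $f:E\to F$ and every continuous function $\delta:E\to(0,\infty)$ there exists a $C^1$ smooth mapping $\varphi:E\to F$ such that $\|f(x)-\varphi(x)\|\leq\delta(x)$ and $D\varphi(x):E\to F$ is surjective for all $x\in E$. (2) For every $C^1$ mapping $\varphi:E\to F$ and every continuous function $\eta:E\to(0,\infty)$ there exists a $C^k$ mapping $g:E\to F$ such that $\|\varphi(x)-g(x)\|\leq\eta(x)$ and $\|D\varphi(x)-Dg(x)\|\leq\eta(x)$ for all $x\in E$. Then, for every continuous mapping $f:E\to F$ and every continuous function $\varepsilon:E\to(0,\infty)$ there exists a $C^k$ smooth mapping $g:E\to F$ such that $\|f(x)-g(x)\|\leq\varepsilon(x)$ and $Dg(x):E\to F$ is surjective for every $x\in E$.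
   Context: All spaces are over $\mathbb{R}$. Smoothness is in the sense of Fréchet; $D$ denotes the Fréchet derivative, and the norm of a derivative is the operator norm. *)

(* Defs.v *)
From HB Require Import structures.
From mathcomp Require Import all_boot all_order all_algebra.
From mathcomp Require Import all_classical all_reals all_analysis.

Set Implicit Arguments.
Unset Strict Implicit.
Unset Printing Implicit Defensive.

Import Order.TTheory GRing.Theory Num.Theory.
Import numFieldNormedType.Exports.

Local Open Scope classical_set_scope.
Local Open Scope ring_scope.

Section ContinuousLinear.
Context {R : realType} (E F : normedModType R).

Definition clin : {pred E -> F} := fun f => `[< linear f /\ continuous f >].

Lemma clinP (f : E -> F) : reflect (linear f /\ continuous f) (f \in clin).
Proof. exact: asboolP. Qed.

Record clinType := CLin { clin_fun :> E -> F ; _ : clin_fun \in clin }.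

HB.instance Definition _ := [isSub for clin_fun].
HB.instance Definition _ := [Choice of clinType by <:].

Lemma clin_submod_closed : submod_closed clin.
Proof.
split.
  apply/clinP; split; first by move=> a x y; rewrite /= scaler0 addr0.
  by move=> x; exact: cst_continuous.
move=> a f g /clinP[lf cf] /clinP[lg cg]; apply/clinP; split.
  move=> b x y.
  rewrite -[LHS]/(a *: f (b *: x + y) + g (b *: x + y)) lf lg.
  rewrite -[RHS]/(b *: (a *: f x + g x) + (a *: f y + g y)).
  by rewrite !scalerDr !scalerA [b * a]mulrC addrACA.
move=> x; apply: continuousD; last exact: cg.
by apply: continuousZl_tmp; exact: cf.
Qed.

HB.instance Definition _ := GRing.isSubmodClosed.Build _ _ clin
  clin_submod_closed.
HB.instance Definition _ := [SubChoice_isSubLmodule of clinType by <:].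

Lemma clin_linear (T : clinType) : linear T.
Proof. by have /clinP[] := valP T. Qed.

HB.instance Definition _ (T : clinType) :=
  GRing.isLinear.Build _ _ _ _ (clin_fun T) (clin_linear T).

Lemma clin_continuous (T : clinType) : continuous T.
Proof. by have /clinP[] := valP T. Qed.

Lemma clin_eqP (S T : clinType) : S =1 T -> S = T.
Proof. by move=> ST; apply: val_inj; apply/funext. Qed.

Lemma clinDE (S T : clinType) x : (S + T) x = S x + T x. Proof. by []. Qed.

Lemma clinZE a (T : clinType) x : (a *: T) x = a *: T x. Proof. by []. Qed.

Definition opnorm (T : clinType) : R :=
  sup [set `|T x| | x in [set x : E | `|x| <= 1]].

Lemma clin_bounded (T : clinType) : exists M, forall x, `|T x| <= M * `|x|.
Proof.
have /linear_bounded_continuous/linear_boundedP : continuous T.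
  exact: clin_continuous.
by move=> /pinfty_ex_gt0[M _ TM]; exists M.
Qed.

Lemma opnorm_has_sup (T : clinType) :
  has_sup [set `|T x| | x in [set x : E | `|x| <= 1]].
Proof.
split; first by exists `|T 0|, 0 => //=; rewrite normr0.
have [M TM] := clin_bounded T.
exists `|M| => _ [x /= x1 <-]; rewrite (le_trans (TM x))//.
rewrite (le_trans (ler_norm _))// normrM normr_id.
by rewrite -[leRHS]mulr1 ler_wpM2l.
Qed.

Lemma opnorm_ub (T : clinType) x : `|x| <= 1 -> `|T x| <= opnorm T.
Proof. by move=> x1; apply: (sup_upper_bound (opnorm_has_sup T)); exists x. Qed.

Lemma opnorm_le (T : clinType) M :
  (forall x, `|x| <= 1 -> `|T x| <= M) -> opnorm T <= M.
Proof.
move=> TM; apply: ge_sup; first by case: (opnorm_has_sup T).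
by move=> _ [x /= x1 <-]; exact: TM.
Qed.

Lemma opnorm_ge0 (T : clinType) : 0 <= opnorm T.
Proof. by apply: le_trans (@opnorm_ub T 0 _); rewrite ?normr0. Qed.

Lemma le_opnorm (T : clinType) x : `|T x| <= opnorm T * `|x|.
Proof.
have [->|x0] := eqVneq x 0; first by rewrite linear0 !normr0 mulr0.
have nx : 0 < `|x| by rewrite normr_gt0.
have nxx : `| `|x|^-1 *: x| <= 1.
  by rewrite normrZ normfV normr_id mulVf// gt_eqF.
have := opnorm_ub T nxx.
by rewrite linearZ normrZ normfV normr_id mulrC ler_pdivrMr.
Qed.

Lemma opnormD (S T : clinType) : opnorm (S + T) <= opnorm S + opnorm T.
Proof.
apply: opnorm_le => x x1; rewrite clinDE (le_trans (ler_normD _ _))//.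
by rewrite lerD// opnorm_ub.
Qed.

Lemma opnormZ a (T : clinType) : opnorm (a *: T) = `|a| * opnorm T.
Proof.
have opnormZ_le b (S : clinType) : opnorm (b *: S) <= `|b| * opnorm S.
  by apply: opnorm_le => x x1; rewrite clinZE normrZ ler_wpM2l// opnorm_ub.
apply/eqP; rewrite eq_le opnormZ_le/=.
have [->|a0] := eqVneq a 0; first by rewrite normr0 mul0r opnorm_ge0.
rewrite -ler_pdivlMl ?normr_gt0// -normfV.
by rewrite (le_trans _ (opnormZ_le _ _))// scalerA mulVf// scale1r.
Qed.

Lemma opnorm_eq0 (T : clinType) : opnorm T = 0 -> T = 0.
Proof.
move=> T0; apply: clin_eqP => x; apply/normr0_eq0/eqP.
by rewrite eq_le normr_ge0 andbT (le_trans (le_opnorm _ _))// T0 mul0r.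
Qed.

HB.instance Definition _ :=
  Lmodule_isNormed.Build R clinType opnormD opnormZ opnorm_eq0.

Lemma clin_normE (T : clinType) : `|T| = opnorm T. Proof. by []. Qed.

End ContinuousLinear.

Notation "''L' ( E , F )" := (clinType E F)
  (at level 8, format "''L' ( E ,  F )") : type_scope.

(* [Frechet f x] is meaningful only where [f] is differentiable: elsewhere
   ['d f x] is unspecified, and [insubd] yields 0 if it is not continuous. *)
Definition Frechet {R : realType} {E F : normedModType R} (f : E -> F) (x : E)
  : 'L(E, F) := insubd (0 : 'L(E, F)) ('d f x : E -> F).

Lemma FrechetE {R : realType} {E F : normedModType R} (f : E -> F) (x : E) :
  differentiable f x -> Frechet f x = 'd f x :> (E -> F).
Proof.
move=> df; rewrite /Frechet -[LHS]/(val _) insubdK//.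
by apply/clinP; split; [exact: linearP|exact: diff_continuous].
Qed.

(* The codomain changes along the recursion, since the derivative of a map
   into [F] is a map into ['L(E, F)]. *)
Fixpoint Cn {R : realType} {E : normedModType R} (n : nat)
    {F : normedModType R} (f : E -> F) : Prop :=
  if n is m.+1 then (forall x, differentiable f x) /\ Cn m (Frechet f)
  else continuous f.

(* [Some n] stands for the finite order n, [None] for infinite order. *)
Definition Ck {R : realType} {E F : normedModType R} (k : option nat)
    (f : E -> F) : Prop :=
  if k is Some n then Cn n f else forall n, Cn n f.

(* Main.v *)
Require Import Defs.
From HB Require Import structures.
From mathcomp Require Import all_boot all_order all_algebra.
From mathcomp Require Import all_classical all_reals all_analysis.
From mathcomp Require Import ring lra.

Set Implicit Arguments.
Unset Strict Implicit.
Unset Printing Implicit Defensive.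

Import Order.TTheory GRing.Theory Num.Theory.
Import numFieldNormedType.Exports.

Local Open Scope classical_set_scope.
Local Open Scope ring_scope.

(** Surjectivity survives small perturbations: the surjective operators form an
    open set for the operator norm, so a map whose derivative is close enough to
    a surjective one, with a tolerance depending on the point, has surjective
    derivatives too.

    First approximate [f] within [epsilon / 2] by a C^1 map [phi] with
    surjective derivatives.  The distance from [Frechet phi x] to the operators
    that are not surjective, truncated at 1, is positive for every [x], and it
    depends continuously on [x] because [Frechet phi] is continuous and a
    distance to a set is 1-Lipschitz ([continuous_radius]).  The smaller of half
    this distance and [epsilon x / 2] is therefore an admissible tolerance for
    approximating [phi] by a C^k map [g] together with its derivative.

    Openness ([open_surjective]) is a form of the open mapping theorem.  Its
    proof goes through a weakening of surjectivity in which the equation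
    [T x = y] is only solved up to a fixed fraction of [`|y|], with a linear
    bound on [x] ([approx_solvable]).  By Baire's theorem in [F] a surjective
    operator has this property for every positive fraction
    ([surjective_approx_solvable]); the property visibly tolerates perturbations
    ([approx_solvable_perturb]); and, by completeness of [E], it implies
    surjectivity as soon as the fraction is less than 1
    ([approx_solvable_surjective]). *)

Definition approx_solvable {R : realType} {E F : normedModType R}
    (C q : R) (T : E -> F) : Prop :=
  forall y, exists2 x, `|x| <= C * `|y| & `|y - T x| <= q * `|y|.

(** Successive corrections are enough: solve approximately for [y], then for the
    residue, and so on.  The residues decay like [q ^+ n], so the corrections
    form an absolutely convergent series, whose sum is an exact solution. *)
Lemma approx_solvable_surjective (R : realType) (E : completeNormedModType R)
    (F : normedModType R) (T : 'L(E, F)) (C q : R) :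
  0 <= q -> q < 1 -> approx_solvable C q T -> set_surj setT setT T.
Proof.
move=> q0 q1 solT y _.
have /choice[s sP] : forall z, exists x,
    `|x| <= C * `|z| /\ `|z - T x| <= q * `|z|.
  by move=> z; have [x ? ?] := solT z; exists x.
pose res n := iter n (fun z => z - T (s z)) y.
pose u n := s (res n).
have res_le n : `|res n| <= q ^+ n * `|y|.
  elim: n => [|n IH]; first by rewrite expr0 mul1r.
  rewrite /= exprS -mulrA; apply: le_trans (sP _).2 _.
  by rewrite ler_wpM2l.
have resE n : res n = y - T (series u n).
  elim: n => [|n IH]; first by rewrite /series /= big_geq// linear0 subr0.
  by rewrite [LHS]/= -/(res n) -/(u n) IH seriesSr linearD opprD addrA.
have u_le n : `|u n| <= geometric (`|C| * `|y|) q n.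
  apply: le_trans (sP _).1 _; rewrite /= -mulrA.
  by rewrite (le_trans (ler_wpM2r _ (ler_norm C)))// ler_wpM2l// mulrC.
have cu : cvgn (series u).
  apply: normed_cvg; apply: series_le_cvg u_le _ => //.
    by move=> n; rewrite geometric_ge0 ?mulr_ge0.
  by apply: is_cvg_geometric_series; rewrite ger0_norm.
exists (limn (series u)) => //.
have res0 : res n @[n --> \oo] --> (0 : F).
  apply: norm_cvg0; apply: (@squeeze_cvgr _ _ _ _ (cst 0) (geometric `|y| q)).
  - by apply: nearW => n; rewrite normr_ge0/= mulrC res_le.
  - exact: cvg_cst.
  - by apply: cvg_geometric; rewrite ger0_norm.
have resl : res n @[n --> \oo] --> y - T (limn (series u)).
  have -> : res = (fun n => y - T (series u n)) by apply/funext.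
  apply: cvgB; first exact: cvg_cst.
  by apply: continuous_cvg => //; exact: clin_continuous.
by apply/esym/eqP; rewrite -subr_eq0; apply/eqP/(cvg_unique _ resl res0).
Qed.

Lemma approx_solvable_perturb (R : realType) (E F : normedModType R)
    (S T : 'L(E, F)) (C q : R) :
  approx_solvable C q T -> approx_solvable C (q + `|T - S| * C) S.
Proof.
move=> solT y; have [x xy Txy] := solT y; exists x => //.
have -> : y - S x = (y - T x) + (T - S) x.
  by rewrite -[(T - S) x]/(T x - S x) addrA subrK.
rewrite (le_trans (ler_normD _ _))// mulrDl lerD//.
rewrite -mulrA (le_trans (le_opnorm _ _))// -clin_normE.
by rewrite ler_wpM2l.
Qed.

(** The closures of the images of the balls of radius [n] cover [F], so one of
    them contains a ball, say [ball y0 r].  If [t *: y] has norm [r / 2], both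
    [y0 + t *: y] and [y0] are nearly images of vectors of norm at most [n]; the
    difference of these two vectors nearly solves for [t *: y], hence after
    division by [t] for [y]. *)
Lemma surjective_approx_solvable (R : realType) (E : normedModType R)
    (F : completeNormedModType R) (T : 'L(E, F)) (q : R) :
  0 < q -> set_surj setT setT T -> exists C, approx_solvable C q T.
Proof.
move=> q0 surjT.
pose A n := closure [set T x | x in [set x : E | `|x| <= n%:R]].
(* Otherwise the intersection of the complements [~` A n] is dense, although it
   is empty because [T] is surjective. *)
have [n ndn] : exists n, ~ dense (~` A n).
  apply/existsNP => dA.
  have /Baire : forall n, open (~` A n) /\ dense (~` A n).
    by move=> n; split => //; apply: closed_openC; exact: closed_closure.
  case/(_ setT) => [|| y [_ Ay]]; [by exists 0|exact: openT|].
  have [x _ Txy] := surjT y I.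
  apply: (Ay (Num.truncn `|x|).+1) => //; apply: subset_closure.
  by exists x => //=; exact/ltW/truncnS_gt.
have [W [[y0 /open_nbhs_nbhs/nbhs_ballP[r /= r0 ballW]] WA]] := denseNE ndn.
have ballA y : ball y0 r y -> A n y.
  move=> /ballW Wy; apply: contrapT => nAy.
  by have : (W `&` ~` A n) y by []; rewrite WA.
have nearA y e : 0 < e -> A n y -> exists2 x, `|x| <= n%:R & `|y - T x| < e.
  move=> e0 /(_ _ (nbhsx_ballx y e e0))[_ [[x /= xn <-]]].
  by rewrite -ball_normE /=; exists x.
exists (4 * n%:R / r) => y.
have [->|y_neq0] := eqVneq y 0.
  exists 0; first by rewrite !normr0 mulr0.
  by rewrite (linear0 T) subr0 normr0 mulr0.
have y_gt0 : 0 < `|y| by rewrite normr_gt0.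
pose t := r / 2 / `|y|.
have t0 : 0 < t by rewrite !divr_gt0.
(* The two errors, of at most this size each, add up to [t * (q * `|y|)], that
   is, to the admissible error [q * `|y|] rescaled by [t]. *)
have d0 : 0 < q * r / 4 by rewrite divr_gt0// mulr_gt0.
have [|x1 x1n Tx1] := nearA (y0 + t *: y) _ d0.
  apply: ballA; rewrite -ball_normE /= opprD addrA subrr add0r normrN normrZ.
  by rewrite gtr0_norm// divfK ?gt_eqF// ltr_pdivrMr// ltr_pMr// ltr1n.
have [|x2 x2n Tx2] := nearA y0 _ d0; first exact/ballA/ballxx.
exists (t^-1 *: (x1 - x2)).
  rewrite normrZ gtr0_norm ?invr_gt0// ler_pdivrMl//.
  apply: le_trans (ler_normB _ _) _.
  have -> : t * (4 * n%:R / r * `|y|) = n%:R + n%:R.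
    by rewrite /t; field; rewrite !gt_eqF.
  exact: lerD.
have -> : y - T (t^-1 *: (x1 - x2)) =
    t^-1 *: ((y0 + t *: y - T x1) - (y0 - T x2)).
  have yE : y = t^-1 *: (y0 + t *: y - y0).
    by rewrite addrAC subrr add0r scalerA mulVf ?gt_eqF// scale1r.
  rewrite {1}yE [T (_ *: _)]linearZ /= [T (_ - _)]linearB -scalerBr.
  by congr (_ *: _); rewrite !opprD !opprK addrACA.
rewrite normrZ gtr0_norm ?invr_gt0// ler_pdivrMl//.
apply: le_trans (ler_normB _ _) _.
have -> : t * (q * `|y|) = q * r / 4 + q * r / 4.
  by rewrite /t; field; rewrite !gt_eqF.
by apply: lerD; exact: ltW.
Qed.

(** A surjective [T] satisfies [approx_solvable C (1/4)] for some [C], and all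
    [S] with [`|T - S|] small compared with [1 / C] still leave a residue
    fraction less than 1. *)
Lemma open_surjective (R : realType) (E F : completeNormedModType R) :
  open [set T : 'L(E, F) | set_surj setT setT T].
Proof.
rewrite openE => T /= surjT.
have [|C solT] := surjective_approx_solvable (q := 4^-1) _ surjT.
  by rewrite invr_gt0.
(* Within this radius the residue fraction 1/4 grows to less than 1/2; adding 1
   to [`|C|] keeps the radius finite when [C] is 0. *)
have C0 : 0 < 4 * (`|C| + 1) by rewrite mulr_gt0// ltr_wpDl.
apply/nbhs_ballP; exists (4 * (`|C| + 1))^-1; first by rewrite /= invr_gt0.
move=> S; rewrite -ball_normE /= => TS.
have q_lt1 : 4^-1 + `|T - S| * `|C| < 1.
  have : `|T - S| * (4 * (`|C| + 1)) < 1 by rewrite -ltr_pdivlMr// div1r.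
  have := normr_ge0 C; have := normr_ge0 (T - S); nra.
have solS : approx_solvable C (4^-1 + `|T - S| * `|C|) S.
  move=> y; have [x xy Sxy] := approx_solvable_perturb S solT y.
  exists x => //; apply: le_trans Sxy _; rewrite ler_wpM2r// lerD2l.
  by rewrite ler_wpM2l// ler_norm.
by apply: approx_solvable_surjective solS => //; rewrite addr_ge0 ?mulr_ge0.
Qed.

(** [sigma] is the distance to the complement of [U], truncated at 1 so that it
    is finite also when [U] is the whole space. *)
Lemma continuous_radius (R : realType) (V : normedModType R) (U : set V) :
  open U -> exists sigma : V -> R,
    [/\ continuous sigma, forall x, U x -> 0 < sigma x &
        forall x y, `|x - y| < sigma x -> U y].
Proof.
move=> openU.
pose D x := 1 |` [set `|x - y| | y in ~` U].
have D_neq0 x : D x !=set0 by exists 1; left.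
have D_ge0 x : lbound (D x) 0.
  by move=> _ [->|[y _ <-]].
have D_lb x : has_lbound (D x) by exists 0.
have sigma_lip x z : inf (D x) <= `|x - z| + inf (D z).
  rewrite -lerBlDl; apply: lb_le_inf => // _ [->|[y Uy <-]]; rewrite lerBlDl.
    by rewrite (le_trans (ge_inf (D_lb x) (or_introl erefl)))// lerDr.
  apply: le_trans (ler_distD z x y); apply: ge_inf => //.
  by right; exists y.
exists (fun x => inf (D x)); split.
- move=> x; apply/cvgrPdist_lt => e e0.
  apply/nbhs_ballP; exists e => //= z; rewrite -ball_normE /= => xz.
  apply: le_lt_trans xz; rewrite ler_norml.
  have := sigma_lip x z; have := sigma_lip z x; rewrite distrC; lra.
- move=> x Ux; move: openU; rewrite openE => /(_ x Ux)/nbhs_ballP[e /= e0 eU].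
  apply: (@lt_le_trans _ _ (Num.min 1 e)); first by rewrite lt_min ltr01.
  apply: lb_le_inf => // _ [->|[y Uy <-]]; first by rewrite ge_min lexx.
  rewrite ge_min; apply/orP; right; rewrite leNgt; apply/negP => xy.
  by apply: Uy; apply: eU; rewrite -ball_normE.
- move=> x y; apply: contraPP => Uy; apply/negP; rewrite -leNgt.
  by apply: ge_inf => //; right; exists y.
Qed.

Theorem proposition1p8 (R : realType) (E F : completeNormedModType R)
  (k : option nat) (k_neq0 : k <> Some 0%N)
  (approx_C1_surjective :
    forall (f : E -> F) (delta : E -> R),
      continuous f -> continuous delta -> (forall x, 0 < delta x) ->
      exists phi : E -> F,
        Ck (Some 1%N) phi /\
        forall x, `|f x - phi x| <= delta x /\
                  set_surj setT setT (Frechet phi x))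
  (approx_C1_by_Ck :
    forall (phi : E -> F) (eta : E -> R),
      Ck (Some 1%N) phi -> continuous eta -> (forall x, 0 < eta x) ->
      exists g : E -> F,
        Ck k g /\
        forall x, `|phi x - g x| <= eta x /\
                  `|Frechet phi x - Frechet g x| <= eta x) :
  forall (f : E -> F) (epsilon : E -> R),
    continuous f -> continuous epsilon -> (forall x, 0 < epsilon x) ->
    exists g : E -> F,
      Ck k g /\
      forall x, `|f x - g x| <= epsilon x /\
                set_surj setT setT (Frechet g x).
Proof.
move=> f epsilon cf cepsilon epsilon_gt0.
have half_continuous (h : E -> R) :
    continuous h -> continuous (fun x => h x / 2).
  by move=> ch x; apply: cvgMr_tmp; exact: ch.
have [phi [C1phi phiP]] := approx_C1_surjective f (fun x => epsilon x / 2) cf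
  (half_continuous _ cepsilon) (fun x => divr_gt0 (epsilon_gt0 x) (ltr0Sn R 1)).
have cDphi : continuous (Frechet phi) by case: C1phi.
have [sigma [csigma sigma_gt0 sigmaP]] :=
  continuous_radius (@open_surjective R E F).
pose rho x := sigma (Frechet phi x).
have crho : continuous rho.
  by move=> x; apply: continuous_comp; [exact: cDphi|exact: csigma].
have rho_gt0 x : 0 < rho x by apply: sigma_gt0; exact: (phiP x).2.
pose eta x := Num.min (epsilon x / 2) (rho x / 2).
have ceta : continuous eta.
  by move=> x; apply: (@continuous_min R E); exact: half_continuous.
have eta_gt0 x : 0 < eta x by rewrite lt_min !divr_gt0.
have [g [Ckg gP]] := approx_C1_by_Ck phi eta C1phi ceta eta_gt0.
exists g; split=> [|x]; first exact: Ckg.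
have [phig Dphig] := gP x; have [fphi _] := phiP x; split.
  rewrite (le_trans (ler_distD (phi x) _ _))// [leRHS]splitr lerD//.
  by rewrite (le_trans phig)// ge_min lexx.
apply: (sigmaP (Frechet phi x)); apply: le_lt_trans Dphig _.
rewrite gt_min; apply/orP; right.
by rewrite -/(rho x) ltr_pdivrMr// ltr_pMr// ltr1n.
Qed.
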